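(* Let $G_\phi$ be a signed graph with sink $q$ and connected underlying graph $G$, and let $(L,M)=(L_{G_\phi},L_G)$ be its chip-firing pair. Then a valid configuration $\vec{c}\in S^+$ is $z$-superstable if and only if $ML^{-1}\vec{c}-M\vec{z}\not\geq\vec{0}$ for every nonzero vector $\vec{z}\in\{0,1\}^n$.
   Context: A signed graph $G_\phi$ is a finite simple graph $G=(V,E)$ with a sign function $\phi:E\to\{+,-\}$. A vertex $q$ is chosen as sink and $v_1,\dots,v_n$ are the other (nonsink) vertices. The reduced signed Laplacian $L=L_{G_\phi}$ is the $n\times n$ matrix with $L_{ii}=\deg_G(v_i)$ (counting edges to $q$) and, for $i\neq j$, $L_{ij}=-1$ if $v_iv_j$ is a positive edge, $+1$ if it is a negative edge, $0$ if it is not an edge. $M=L_G$ is the same matrix for the all-positive signing (the usual reduced Laplacian of $G$). With $G$ connected, both are invertible and $M^{-1}$ has nonnegative entries. The valid configurations are $S^+=\{\vec{c}\in\mathbb{Z}^n: ML^{-1}\vec{c}\ge\vec{0}\}$ (equivalently the integer vectors of the form $LM^{-1}\vec{x}$, $\vec{x}\in\mathbb{R}^n_{\ge0}$). A configuration $\vec{c}\in S^+$ is $z$-superstable if $\vec{c}-L\vec{z}\notin S^+$ for all nonzero $\vec{z}\in\mathbb{Z}^n_{\ge0}$. Inequalities between vectors are entrywise; $\vec{v}\not\ge\vec{0}$ means some entry of $\vec{v}$ is negative. *)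

(* Defs.v *)
From HB Require Import structures.
From mathcomp Require Import all_boot all_order all_algebra.

Set Implicit Arguments.
Unset Strict Implicit.
Unset Printing Implicit Defensive.

Import Order.TTheory GRing.Theory Num.Theory.
Local Open Scope ring_scope.

Record simple_graph (V : finType) := SimpleGraph {
  adj :> rel V;
  adj_sym : symmetric adj;
  adj_irr : irreflexive adj
}.

Definition connected (V : finType) (G : simple_graph V) : Prop :=
  forall x y : V, connect G x y.

Definition degree (V : finType) (G : simple_graph V) (x : V) : nat :=
  #|[set y | G x y]|.

(* An edge is the unordered pair [set x; y]; [true] stands for the sign +.
   Only the values on the edges of the graph are ever used. *)
Definition signing (V : finType) := {set V} -> bool.

Definition all_positive (V : finType) : signing V := fun _ => true.

Definition enumerates_nonsinks (V : finType) (q : V) (n : nat)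
    (v : 'I_n -> V) : Prop :=
  injective v /\ codom v =i predC1 q.

(* The sink is the only vertex not listed by [v]; it still counts in the
   degrees on the diagonal. *)
Definition reduced_laplacian (V : finType) (G : simple_graph V)
    (phi : signing V) (n : nat) (v : 'I_n -> V) : 'M[int]_n :=
  \matrix_(i, j)
    if i == j then (degree G (v i))%:Z
    else if G (v i) (v j) then
      (if phi [set v i; v j] then -1 else 1)
    else 0.

Definition toQ (m n : nat) (A : 'M[int]_(m, n)) : 'M[rat]_(m, n) :=
  map_mx intr A.

Definition nonneg (R : numDomainType) (n : nat) (u : 'cV[R]_n) : bool :=
  [forall i, 0 <= u i 0].

Definition valid_config (n : nat) (L M : 'M[int]_n) (c : 'cV[int]_n) : bool :=
  nonneg (toQ M *m invmx (toQ L) *m toQ c).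

Definition z_superstable (n : nat) (L M : 'M[int]_n) (c : 'cV[int]_n) : Prop :=
  valid_config L M c /\
  forall z : 'cV[int]_n, nonneg z -> z != 0 -> ~~ valid_config L M (c - L *m z).

(* Main.v *)
Require Import Defs.
From HB Require Import structures.
From mathcomp Require Import all_boot all_order all_algebra.

(** Write [y = M L^-1 c].  As soon as [L] is invertible,
    [M L^-1 (c - L z) = y - M z], so that z-superstability of [c] means that
    [y - M z] has a negative entry for every nonzero [z >= 0]
    ([valid_config_subE]).  The theorem thus asserts that it suffices to fire
    sets of vertices, and this concerns [M] alone.

    Given a nonzero integer vector [z >= 0], fire the set of the vertices at
    which [z] is maximal, with indicator vector [z'].  At a vertex outside this
    set, [M z'] is nonpositive because the off-diagonal entries of [M] are.  At
    a vertex of the set, the remainder [z - z'] is nonnegative and attains its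
    maximum, so [M (z - z')] is nonnegative there because the row sums of [M]
    are nonnegative.  Each entry of [M z'] is therefore bounded by [0] or by the
    same entry of [M z] ([exists_indicator_firing]), and [y - M z >= 0] together
    with [y >= 0] yields [y - M z' >= 0].

    Invertibility of [L] is where connectedness enters.  If [L x = 0], then
    [|x|], extended by [0] at the sink, is at most its average over the
    neighbours at each nonsink vertex, whatever the signs of the edges.  By the
    maximum principle ([subharmonic_le_sink]) it is maximal at the sink, hence
    it vanishes. *)

Set Implicit Arguments.
Unset Strict Implicit.
Unset Printing Implicit Defensive.

Import Order.TTheory GRing.Theory Num.Theory.
Local Open Scope ring_scope.

(** If the maximum were not reached at [q], the set of the points where it is
    reached would be closed under adjacency: a value that is both maximal and
    at most the average of the neighbouring ones is equal to all of them.
    Connectedness would then put [q] in this set. *)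
Lemma subharmonic_le_sink (R : realDomainType) (V : finType)
    (G : simple_graph V) (q : V) (f : V -> R) :
  connected G ->
  (forall u, u != q -> f u *+ degree G u <= \sum_(w | G u w) f w) ->
  forall u, f u <= f q.
Proof.
move=> hG hf.
have [u0 _ max0] := @arg_maxP _ _ _ q predT f isT.
have le0 u : f u <= f u0 by exact: max0.
suff <- : f u0 = f q by [].
apply: contraTeq (hG u0 q) => ne0q.
have step u w : G u w -> f u = f u0 -> f w = f u0.
  move=> Guw fu.
  have uq : u != q by apply: contraNneq ne0q => uq; rewrite -fu uq.
  have := hf _ uq.
  rewrite fu /degree cardsE -sumr_const -subr_le0 -sumrB => sum_le0.
  have ge0 x : G u x -> 0 <= f u0 - f x by move=> _; rewrite subr_ge0.
  have sum0 : \sum_(x | G u x) (f u0 - f x) = 0.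
    by apply: le_anti; rewrite sum_le0 sumr_ge0.
  by apply/esym/eqP; rewrite -subr_eq0; apply/eqP/(psumr_eq0P ge0).
have clo : closed G [pred u | f u == f u0].
  move=> u w Guw; rewrite !inE; apply/eqP/eqP; first exact: step.
  by apply: step; rewrite adj_sym.
apply/negP => /(closed_connect clo).
by rewrite !inE eqxx (eq_sym (f q)) (negbTE ne0q).
Qed.

Section ReducedLaplacian.

Variables (V : finType) (G : simple_graph V) (phi : signing V).
Variables (q : V) (n : nat) (v : 'I_n -> V).
Hypothesis hv : enumerates_nonsinks q v.

Lemma reduced_laplacian_norm_entry (i j : 'I_n) : i != j ->
  `|reduced_laplacian G phi v i j| = (G (v i) (v j))%:R.
Proof.
move=> ij; rewrite mxE (negbTE ij).
by case: (G _ _); [case: (phi _) | ].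
Qed.

Lemma reduced_laplacian_ker (x : 'cV[rat]_n) :
  connected G -> toQ (reduced_laplacian G phi v) *m x = 0 -> x = 0.
Proof.
case: hv => inj_v codom_v hG Lx0.
(* the function |x|, extended by 0 at the sink *)
pose f w := \sum_(j | v j == w) `|x j 0|.
have f_v i : f (v i) = `|x i 0|.
  rewrite /f (eq_bigl (pred1 i)) ?big_pred1_eq // => j.
  by rewrite /= (inj_eq inj_v).
have f_q : f q = 0.
  rewrite /f big_pred0 // => j; apply/negbTE.
  by have := codom_f v j; rewrite codom_v inE.
have subh u : u != q -> f u *+ degree G u <= \sum_(w | G u w) f w.
  move=> uq; have /codomP[i ->] : u \in codom v by rewrite codom_v.
  have -> : \sum_(w | G (v i) w) f w = \sum_(j | G (v i) (v j)) `|x j 0|.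
    rewrite /f (exchange_big_dep (fun j => G (v i) (v j))) /=; last first.
      by move=> w j Gw /eqP->.
    apply: eq_bigr => j Gj.
    rewrite (eq_bigl (pred1 (v j))) ?big_pred1_eq // => w.
    by rewrite /= eq_sym andbC; case: eqP => // ->; rewrite Gj.
  move/matrixP/(_ i 0): Lx0; rewrite mxE (bigD1 i) //= !mxE eqxx => /eqP.
  rewrite addr_eq0 => /eqP/(congr1 Num.norm).
  rewrite normrN normrM -pmulrn normr_nat mulr_natl f_v => ->.
  apply: le_trans (ler_norm_sum _ _ _) _.
  rewrite [leRHS]big_mkcond [leLHS]big_mkcond /=; apply: ler_sum => j _.
  case: (eqVneq j i) => [->|ji]; first by rewrite adj_irr.
  rewrite mxE normrM -intr_norm reduced_laplacian_norm_entry 1?eq_sym //.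
  by case: (G _ _); rewrite ?mul1r ?mul0r.
apply/matrixP => i j; rewrite ord1 mxE; apply/eqP.
by rewrite -normr_le0 -f_v -f_q; apply: subharmonic_le_sink.
Qed.

Lemma reduced_laplacian_unit :
  connected G -> toQ (reduced_laplacian G phi v) \in unitmx.
Proof.
move=> hG; rewrite unitmxE unitfE -det_tr; apply/negP => /det0P[x xn0 xL0].
case/eqP: xn0; apply: trmx_inj; rewrite trmx0.
apply: reduced_laplacian_ker => //.
by rewrite -[LHS]trmxK trmx_mul trmxK xL0 trmx0.
Qed.

Lemma reduced_laplacian_offdiag_le0 (i j : 'I_n) : i != j ->
  reduced_laplacian G (@all_positive V) v i j <= 0.
Proof. by move=> ij; rewrite mxE (negbTE ij); case: (G _ _). Qed.

(** The [i]-th row sum counts the edges between [v i] and the sink. *)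
Lemma reduced_laplacian_rowsum_ge0 (i : 'I_n) :
  0 <= \sum_j reduced_laplacian G (@all_positive V) v i j.
Proof.
case: hv => inj_v _; rewrite (bigD1 i) //= mxE eqxx.
have -> : \sum_(j | j != i) reduced_laplacian G (@all_positive V) v i j
    = - (#|[set j | G (v i) (v j)]|%:Z).
  rewrite -[_%:Z]natz -sum1_card natr_sum -sumrN big_mkcond [RHS]big_mkcond /=.
  apply: eq_bigr => j _; rewrite inE mxE eq_sym.
  by case: eqVneq => [<-|_]; [rewrite adj_irr | case: (G _ _)].
rewrite subr_ge0 lez_nat /degree -(card_imset _ inj_v); apply: subset_leq_card.
by apply/subsetP => w /imsetP[j]; rewrite !inE => Gj ->.
Qed.

End ReducedLaplacian.

(** The indicator vector is that of the set where [z] is maximal; on this set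
    the remainder [z - z'] is still maximal, precisely because [z] has integer
    entries. *)
Lemma exists_indicator_firing (n : nat) (M : 'M[int]_n) (z : 'cV[int]_n) :
  (forall i j, i != j -> M i j <= 0) -> (forall i, 0 <= \sum_j M i j) ->
  nonneg z -> z != 0 ->
  exists z' : 'cV[int]_n,
    [/\ forall i, z' i 0 = 0 \/ z' i 0 = 1, z' != 0
      & forall i, (M *m z') i 0 <= 0 \/ (M *m z') i 0 <= (M *m z) i 0].
Proof.
move=> offM rowM /forallP z_ge0 z_n0.
have /cV0Pn[i1 zi1] := z_n0.
have [i0 _ max0] := @arg_maxP _ _ _ i1 predT (fun i => z i 0) isT.
have le0 i : z i 0 <= z i0 0 by exact: max0.
have z0_gt0 : 0 < z i0 0.
  by apply: lt_le_trans (le0 i1); rewrite lt_neqAle eq_sym zi1 z_ge0.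
pose z' : 'cV[int]_n := \col_i (z i 0 == z i0 0)%:R.
exists z'; split=> [i||i].
- by rewrite mxE; case: eqP; [right | left].
- by apply/cV0Pn; exists i0; rewrite mxE eqxx.
have [zi|zi] := eqVneq (z i 0) (z i0 0); last first.
  left; rewrite mxE; apply: sumr_le0 => j _; rewrite !mxE.
  case: (eqVneq i j) => [<-|ij]; first by rewrite (negbTE zi) mulr0.
  by rewrite mulr_le0_ge0 ?ler0n ?offM.
right; rewrite -subr_ge0.
have -> : (M *m z) i 0 - (M *m z') i 0 = \sum_j M i j * (z j 0 - z' j 0).
  by rewrite !mxE -sumrB; apply: eq_bigr => j _; rewrite mulrBr.
(* compare with the constant vector whose entries are the maximum of z - z' *)
apply: (@le_trans _ _ (\sum_j M i j * (z i0 0 - 1))).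
  rewrite -mulr_suml mulr_ge0 ?rowM // subr_ge0.
  by rewrite -gtz0_ge1.
apply: ler_sum => j _; rewrite mxE.
case: (eqVneq i j) => [<-|ij]; first by rewrite zi eqxx.
rewrite ler_wnM2l ?offM //.
case: (eqVneq (z j 0)) => [->|zj] //.
by rewrite subr0 lerBrDr -ltzD1 ltrD2r lt_neqAle zj le0.
Qed.

Lemma valid_config_subE (n : nat) (L M : 'M[int]_n) (c z : 'cV[int]_n) :
  toQ L \in unitmx ->
  valid_config L M (c - L *m z)
    = nonneg (toQ M *m invmx (toQ L) *m toQ c - toQ M *m toQ z).
Proof.
move=> unitL; rewrite /valid_config {3}/toQ map_mxB map_mxM mulmxBr.
by rewrite -!/(toQ _) [X in _ - X]mulmxA mulmxKV.
Qed.

Theorem theorem3p5 (V : finType) (G : simple_graph V) (phi : signing V)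
    (q : V) (n : nat) (v : 'I_n -> V)
    (hG : connected G) (hv : enumerates_nonsinks q v) :
  let L := reduced_laplacian G phi v in
  let M := reduced_laplacian G (@all_positive V) v in
  forall c : 'cV[int]_n, valid_config L M c ->
  (z_superstable L M c <->
   forall z : 'cV[int]_n,
     (forall i, z i 0 = 0 \/ z i 0 = 1) -> z != 0 ->
     ~~ nonneg (toQ M *m invmx (toQ L) *m toQ c - toQ M *m toQ z)).
Proof.
move=> L M c valid_c.
have unitL : toQ L \in unitmx by exact: reduced_laplacian_unit hv hG.
split=> [[_ stable_c] z z01 zn0 | stable01].
  rewrite -valid_config_subE //; apply: stable_c => //.
  by apply/forallP => i; case: (z01 i) => ->.
split=> // z z_ge0 zn0; rewrite valid_config_subE //.
have [z' [z'01 z'n0 z'_le]] := exists_indicator_firing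
  (@reduced_laplacian_offdiag_le0 V G n v)
  (reduced_laplacian_rowsum_ge0 G hv) z_ge0 zn0.
apply: contra (stable01 z' z'01 z'n0).
move: valid_c; rewrite /valid_config.
set y := _ *m toQ c => /forallP y_ge0.
have entryE w i :
    (y - toQ M *m toQ w) i 0 = y i 0 - ((M *m w) i 0)%:~R.
  by rewrite -map_mxM mxE; congr (_ + _); rewrite mxE [in LHS]mxE.
move=> /forallP yz_ge0; apply/forallP => i.
have := yz_ge0 i; have := y_ge0 i; rewrite !entryE.
case: (z'_le i); rewrite -(ler_int rat) => le_i y_i yz_i.
  by rewrite subr_ge0 (le_trans le_i).
by apply: le_trans yz_i _; rewrite lerD2l lerN2.
Qed.
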